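(* Let $N\in\mathbb{N}$, $2N\le n$, $p=s_0=2N$, $S_0=\{1,\ldots,2N\}$, and let $X=(X_1,\ldots,X_{2N})\in\mathbb{R}^{n\times 2N}$ be a fair design such that for each $k\in\{1,\ldots,N\}$ the columns $X_{2k-1},X_{2k}$ are orthogonal to the space spanned by the remaining columns. Assume $\hat\rho_k:=-X_{2k-1}^TX_{2k}>0$ and write $\hat\varphi_k^2:=1-\hat\rho_k$ for all $k$. Let $\lambda>0$ and suppose that for all $k$, $\beta_{2k-1}^0\ge\beta_{2k}^0\ge\lambda/\hat\varphi_k^2$. Then the noiseless Lasso $\beta^*$ satisfies $$\|X(\beta^*-\beta^0)\|_2^2=\frac{\lambda^2s_0}{\hat\phi^2(S_0)}=2\lambda^2\|1/\hat\varphi^2\|_1$$ and $$\|X(\beta^*-\beta^0)\|_2^2+\lambda\|\beta^*\|_1=\lambda\|\beta^0\|_1.$$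
   Context: Fair design: all columns satisfy $\|X_j\|_2=1$ and there are no $j\ne k$ and constant $b$ with $X_j=bX_k$. The noiseless Lasso is $\beta^*:=\arg\min_{\beta\in\mathbb{R}^p}\{\|X(\beta-\beta^0)\|_2^2+2\lambda\|\beta\|_1\}$. Here $\|1/\hat\varphi^2\|_1:=\sum_{k=1}^N1/\hat\varphi_k^2$. The compatibility constant for $S_0=\{1,\ldots,p\}$ is $\hat\phi^2(S_0):=\min\{s_0\|X\beta\|_2^2:\ \beta\in\mathbb{R}^p,\ \|\beta\|_1=1\}$. *)

(* Defs.v *)
From mathcomp Require Import all_boot all_order all_algebra.
From mathcomp Require Import boolp classical_sets reals.
Set Implicit Arguments.
Unset Strict Implicit.
Unset Printing Implicit Defensive.
Import Order.TTheory GRing.Theory Num.Theory.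
Local Open Scope classical_set_scope.
Local Open Scope ring_scope.

Definition dotp (R : realType) (n : nat) (u v : 'cV[R]_n) : R :=
  (u^T *m v) ord0 ord0.

Definition norm1 (R : realType) (n : nat) (v : 'cV[R]_n) : R :=
  \sum_(i < n) `|v i ord0|.

Definition norm2 (R : realType) (n : nat) (v : 'cV[R]_n) : R :=
  Num.sqrt (\sum_(i < n) v i ord0 ^+ 2).

Definition fair_design (R : realType) (n p : nat) (X : 'M[R]_(n, p)) : Prop :=
  (forall j : 'I_p, norm2 (col j X) = 1) /\
  ~ (exists (j k : 'I_p) (b : R), j <> k /\ col j X = b *: col k X).

(* [b] belongs to the argmin; uniqueness of the minimizer is not built in. *)
Definition noiseless_lasso (R : realType) (n p : nat) (X : 'M[R]_(n, p))
    (beta0 : 'cV[R]_p) (lambda : R) (b : 'cV[R]_p) : Prop :=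
  forall c : 'cV[R]_p,
    norm2 (X *m (b - beta0)) ^+ 2 + 2 * lambda * norm1 b <=
    norm2 (X *m (c - beta0)) ^+ 2 + 2 * lambda * norm1 c.

(* An attained minimum, not an infimum: the value is the least element of [A],
   and the junk value 0 when [A] has none. *)
Definition set_min (R : realType) (A : set R) : R :=
  xget 0 [set m | A m /\ forall x, A x -> m <= x].

(* The squared compatibility constant of the full active set, for which
   s_0 = p. *)
Definition compat2_full (R : realType) (n p : nat) (X : 'M[R]_(n, p)) : R :=
  set_min [set p%:R * norm2 (X *m b) ^+ 2 |
            b in [set b : 'cV[R]_p | norm1 b = 1]].

Lemma pair_fst_subproof (N : nat) (k : 'I_N) : (2 * k < 2 * N)%N.
Proof. by rewrite ltn_pmul2l. Qed.

Lemma pair_snd_subproof (N : nat) (k : 'I_N) : ((2 * k).+1 < 2 * N)%N.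
Proof. by rewrite !mul2n -doubleS leq_double. Qed.

(* Indices start at 0 here, so with k' = k + 1 in {1, ..., N} these are the
   1-based column indices 2k' - 1 and 2k'. *)
Definition pair_fst (N : nat) (k : 'I_N) : 'I_(2 * N) :=
  Ordinal (pair_fst_subproof k).

Definition pair_snd (N : nat) (k : 'I_N) : 'I_(2 * N) :=
  Ordinal (pair_snd_subproof k).

Definition pairs_orthogonal (R : realType) (n N : nat)
    (X : 'M[R]_(n, 2 * N)) : Prop :=
  forall (k : 'I_N) (v : 'cV[R]_n),
    v \in span [seq col j X | j <- enum 'I_(2 * N)
                            & (j != pair_fst k) && (j != pair_snd k)] ->
    dotp (col (pair_fst k) X) v = 0 /\ dotp (col (pair_snd k) X) v = 0.

Definition rhohat (R : realType) (n N : nat) (X : 'M[R]_(n, 2 * N))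
    (k : 'I_N) : R :=
  - dotp (col (pair_fst k) X) (col (pair_snd k) X).

Definition varphihat2 (R : realType) (n N : nat) (X : 'M[R]_(n, 2 * N))
    (k : 'I_N) : R :=
  1 - rhohat X k.

(* Main.v *)
(** The Gram matrix is block diagonal with blocks [[1, -rho_k], [-rho_k, 1]], so
    |X v|^2 is a sum of two-variable quadratic forms and both optimization
    problems decouple over the pairs. The vector equal to lambda / varphi_k^2 on
    the k-th pair is mapped by the Gram matrix to the constant vector lambda, so
    beta0 minus this vector, which is nonnegative by assumption, satisfies the
    KKT conditions; positive definiteness makes it the only minimizer. On a pair
    the form is at least varphi_k^2 t^2 / 2 with t = |a| + |c|, with equality at
    a = c, so the compatibility constant is the minimum of
    p * sum_k varphi_k^2 t_k^2 / 2 over sum_k t_k = 1, which is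
    N / sum_k 1 / varphi_k^2. *)
Require Import Defs.
From mathcomp Require Import all_boot all_order all_algebra.
From mathcomp Require Import boolp classical_sets reals.
From mathcomp Require Import zify ring lra.
Set Implicit Arguments.
Unset Strict Implicit.
Unset Printing Implicit Defensive.
Import Order.TTheory GRing.Theory Num.Theory.
Local Open Scope ring_scope.


(** * Least elements and the Euclidean inner product *)

Lemma set_minE (R : realType) (A : set R) (m : R) :
  A m -> (forall x, A x -> m <= x) -> set_min A = m.
Proof.
move=> Am mA; rewrite /set_min; apply: xget_unique => // y [Ay yA].
by apply/eqP; rewrite eq_le yA // mA.
Qed.

Lemma dotpE (R : realType) (n : nat) (u v : 'cV[R]_n) :
  dotp u v = \sum_i u i ord0 * v i ord0.
Proof. by rewrite /dotp !mxE; apply: eq_bigr => i _; rewrite !mxE. Qed.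

Lemma dotpC (R : realType) (n : nat) (u v : 'cV[R]_n) : dotp u v = dotp v u.
Proof. by rewrite !dotpE; apply: eq_bigr => i _; rewrite mulrC. Qed.

Lemma dotpDl (R : realType) (n : nat) (u v w : 'cV[R]_n) :
  dotp (u + v) w = dotp u w + dotp v w.
Proof. by rewrite /dotp linearD mulmxDl mxE. Qed.

Lemma norm2_sqr (R : realType) (n : nat) (v : 'cV[R]_n) :
  norm2 v ^+ 2 = dotp v v.
Proof.
rewrite /norm2 dotpE sqr_sqrtr; last by apply: sumr_ge0 => i _; exact: sqr_ge0.
by apply: eq_bigr.
Qed.

Lemma dotpvv_ge0 (R : realType) (n : nat) (v : 'cV[R]_n) : 0 <= dotp v v.
Proof. by rewrite -norm2_sqr sqr_ge0. Qed.

Lemma dotpvv_eq0 (R : realType) (n : nat) (v : 'cV[R]_n) :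
  dotp v v = 0 -> v = 0.
Proof.
rewrite dotpE => /eqP; rewrite psumr_eq0; last first.
  by move=> i _; rewrite -expr2 sqr_ge0.
move=> /allP v0; apply/matrixP => i j; rewrite (ord1 j) mxE; apply/eqP.
by have := v0 i (mem_index_enum i); rewrite -expr2 sqrf_eq0.
Qed.

(** * Splitting indices into pairs *)

Lemma pair_fst_neq_snd (N : nat) (k l : 'I_N) : pair_fst k != pair_snd l.
Proof. by rewrite -val_eqE /=; apply/negP => /eqP; lia. Qed.

Lemma pair_fst_inj (N : nat) : injective (@pair_fst N).
Proof. by move=> k l /(congr1 val) /= kl; apply/val_inj => /=; lia. Qed.

Lemma pair_snd_inj (N : nat) : injective (@pair_snd N).
Proof. by move=> k l /(congr1 val) /= kl; apply/val_inj => /=; lia. Qed.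

Lemma half_ord_subproof (N : nat) (i : 'I_(2 * N)) : (i./2 < N)%N.
Proof. by have := ltn_ord i; lia. Qed.

Definition half_ord (N : nat) (i : 'I_(2 * N)) : 'I_N :=
  Ordinal (half_ord_subproof i).

Lemma half_pair_fst (N : nat) (k : 'I_N) : half_ord (pair_fst k) = k.
Proof. by apply/val_inj => /=; lia. Qed.

Lemma half_pair_snd (N : nat) (k : 'I_N) : half_ord (pair_snd k) = k.
Proof. by apply/val_inj => /=; lia. Qed.

Lemma pair_snd_half (N : nat) (i : 'I_(2 * N)) :
  odd i -> pair_snd (half_ord i) = i.
Proof. by move=> oi; apply/val_inj => /=; lia. Qed.

Lemma pair_fst_half (N : nat) (i : 'I_(2 * N)) :
  ~~ odd i -> pair_fst (half_ord i) = i.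
Proof. by move=> ei; apply/val_inj => /=; lia. Qed.

(** Halving and parity give the inverse of the map from (pair number, position in the pair) to
    indices. *)
Lemma sum_pairs (R : realType) (N : nat) (F : 'I_(2 * N) -> R) :
  \sum_i F i = \sum_(k < N) (F (pair_fst k) + F (pair_snd k)).
Proof.
pose h (kb : 'I_N * bool) := if kb.2 then pair_snd kb.1 else pair_fst kb.1.
rewrite (reindex h); last first.
  exists (fun i => (half_ord i, odd i)) => [[k b] _|i _].
    by case: b; rewrite /h /= ?half_pair_fst ?half_pair_snd; congr pair; lia.
  by rewrite /h /=; case: ifP => [/pair_snd_half|/negbT/pair_fst_half].
rewrite -(pair_bigA _ (fun k b => F (h (k, b)))) /=; apply: eq_bigr => k _.
by rewrite (bigD1 false) //= (bigD1 true) //= big1 ?addr0 // => -[].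
Qed.

Lemma cV_pairs_eq (R : realType) (N : nat) (u v : 'cV[R]_(2 * N)) :
  (forall k, u (pair_fst k) ord0 = v (pair_fst k) ord0 /\
             u (pair_snd k) ord0 = v (pair_snd k) ord0) -> u = v.
Proof.
move=> uv; apply/matrixP => i j; rewrite (ord1 j).
have [uvf uvs] := uv (half_ord i).
case/boolP: (odd i) => [/pair_snd_half|/pair_fst_half] <- //.
Qed.

(** * The block-diagonal Gram matrix *)

Lemma dotp_pairs_eq0 (R : realType) (n N : nat) (X : 'M[R]_(n, 2 * N)) k j :
  pairs_orthogonal X -> j != pair_fst k -> j != pair_snd k ->
  dotp (col (pair_fst k) X) (col j X) = 0 /\
  dotp (col (pair_snd k) X) (col j X) = 0.
Proof.
move=> Xo jf js; apply: Xo; apply: memv_span; apply/mapP; exists j => //.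
by rewrite mem_filter jf js mem_enum.
Qed.

Lemma dotp_mulmx (R : realType) (n p : nat) (X : 'M[R]_(n, p))
    (v : 'cV[R]_p) :
  dotp (X *m v) (X *m v) =
  \sum_j \sum_l v j ord0 * v l ord0 * dotp (col j X) (col l X).
Proof.
have -> : dotp (X *m v) (X *m v) = (v^T *m ((X^T *m X) *m v)) ord0 ord0.
  by rewrite /dotp trmx_mul !mulmxA.
rewrite mxE; apply: eq_bigr => j _; rewrite !mxE mulr_sumr.
apply: eq_bigr => l _; rewrite dotpE !mxE -mulrA; congr (_ * _).
by rewrite mulrC; congr (_ * _); apply: eq_bigr => i _; rewrite !mxE.
Qed.

Definition pair_form (R : realType) (rho a c : R) : R :=
  a ^+ 2 + c ^+ 2 - 2 * rho * (a * c).

(** Orthogonality kills the cross terms between distinct pairs; inside a pair the Gram entries are 1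
    and [- rhohat X k]. *)
Lemma norm2_mulmx_pairs (R : realType) (n N : nat) (X : 'M[R]_(n, 2 * N))
    (v : 'cV[R]_(2 * N)) :
  fair_design X -> pairs_orthogonal X ->
  norm2 (X *m v) ^+ 2 =
  \sum_(k < N) pair_form (rhohat X k) (v (pair_fst k) ord0)
                                      (v (pair_snd k) ord0).
Proof.
move=> [X1 _] Xo; rewrite norm2_sqr dotp_mulmx sum_pairs.
apply: eq_bigr => k _; rewrite !sum_pairs -big_split /= (bigD1 k) //=.
rewrite [X in _ + X]big1 ?addr0 => [|l lk].
  have dotp1 j : dotp (col j X) (col j X) = 1.
    by rewrite -norm2_sqr X1 expr1n.
  rewrite !dotp1 (dotpC (col (pair_snd k) X)) /pair_form /rhohat; ring.
have lf : pair_fst l != pair_fst k by rewrite (inj_eq (@pair_fst_inj N)).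
have ls : pair_snd l != pair_snd k by rewrite (inj_eq (@pair_snd_inj N)).
have ls' : pair_snd l != pair_fst k by rewrite eq_sym pair_fst_neq_snd.
have [-> ->] := dotp_pairs_eq0 Xo lf (pair_fst_neq_snd l k).
have [-> ->] := dotp_pairs_eq0 Xo ls' ls.
by rewrite !mulr0 !addr0.
Qed.

Lemma norm1_pairs (R : realType) (N : nat) (v : 'cV[R]_(2 * N)) :
  norm1 v = \sum_(k < N) (`|v (pair_fst k) ord0| + `|v (pair_snd k) ord0|).
Proof. by rewrite /norm1 sum_pairs. Qed.

(** The squared norm of the sum of the two columns is twice [varphihat2 X k]. If it vanished, one
    column would be -1 times the other, against fairness. *)
Lemma varphihat2_gt0 (R : realType) (n N : nat) (X : 'M[R]_(n, 2 * N)) k :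
  fair_design X -> 0 < varphihat2 X k.
Proof.
move=> [X1 Xnp]; rewrite /varphihat2 /rhohat opprK.
set x := col (pair_fst k) X; set y := col (pair_snd k) X.
have dotp1 j : dotp (col j X) (col j X) = 1 by rewrite -norm2_sqr X1 expr1n.
have xyE : dotp (x + y) (x + y) = 2 * (1 + dotp x y).
  rewrite dotpDl dotpC dotpDl (dotpC y (x + y)) dotpDl !dotp1 (dotpC y); ring.
rewrite lt_neqAle; apply/andP; split; last first.
  by have := dotpvv_ge0 (x + y); rewrite xyE pmulr_rge0.
apply/negP => /eqP xy0; apply: Xnp.
exists (pair_fst k), (pair_snd k), (-1); split.
  by apply/eqP; exact: pair_fst_neq_snd.
apply/eqP; rewrite scaleN1r -addr_eq0; apply/eqP/dotpvv_eq0.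
by rewrite -/x -/y xyE -xy0 mulr0.
Qed.

(** * Inequalities for the form on one pair *)

(** The difference of the two sides is rho (a - c)^2 + (1 - rho) / 2 (|a| - |c|)^2. *)
Lemma pair_form_ge (R : realType) (rho a c : R) : 0 <= rho -> rho < 1 ->
  (1 - rho) / 2 * (`|a| + `|c|) ^+ 2 <= pair_form rho a c.
Proof.
move=> r0 r1.
have: 0 <= rho * (a - c) ^+ 2 by rewrite mulr_ge0 // sqr_ge0.
have: 0 <= (1 - rho) * (`|a| - `|c|) ^+ 2.
  by rewrite mulr_ge0 ?sqr_ge0 // subr_ge0 ltW.
rewrite /pair_form -(real_normK (num_real a)) -(real_normK (num_real c)) => h.
have -> : (a - c) ^+ 2 = `|a| ^+ 2 + `|c| ^+ 2 - 2 * (a * c).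
  by rewrite !real_normK ?num_real //; ring.
move: h; nra.
Qed.

Lemma pair_form_eq0 (R : realType) (rho a c : R) : 0 <= rho -> rho < 1 ->
  pair_form rho a c = 0 -> a = 0 /\ c = 0.
Proof.
move=> r0 r1 q0; have := pair_form_ge a c r0 r1; rewrite q0.
rewrite pmulr_rle0; last by lra.
rewrite le_eqVlt ltNge sqr_ge0 orbF sqrf_eq0 paddr_eq0 ?normr_ge0 //.
by rewrite !normr_eq0 => /andP[/eqP-> /eqP->].
Qed.

(* Stationarity of [pair_form] at [(d, d)]: its half-gradient there is
   [(1 - rho) * d = lambda] in both coordinates, the slope of the penalty. *)
Lemma pair_objective_ge (R : realType) (rho lambda a0 c0 d a c : R) :
  0 <= lambda -> (1 - rho) * d = lambda ->
  pair_form rho d d + 2 * lambda * ((a0 - d) + (c0 - d)) +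
    pair_form rho (a - (a0 - d)) (c - (c0 - d)) <=
  pair_form rho (a - a0) (c - c0) + 2 * lambda * (`|a| + `|c|).
Proof.
move=> l0 ld; rewrite -subr_ge0.
suff -> : pair_form rho (a - a0) (c - c0) + 2 * lambda * (`|a| + `|c|) -
    (pair_form rho d d + 2 * lambda * ((a0 - d) + (c0 - d)) +
     pair_form rho (a - (a0 - d)) (c - (c0 - d))) =
    2 * lambda * ((`|a| - a) + (`|c| - c)).
  by rewrite !mulr_ge0 // addr_ge0 // subr_ge0 ler_norm.
rewrite -ld /pair_form; ring.
Qed.

Lemma rhohat_lt1 (R : realType) (n N : nat) (X : 'M[R]_(n, 2 * N)) k :
  fair_design X -> rhohat X k < 1.
Proof. by move=> /(varphihat2_gt0 k); rewrite subr_gt0. Qed.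

(** Both the minimizer for the compatibility constant and the Lasso shift have this shape. *)
Definition pair_const (R : realType) (N : nat) (f : 'I_N -> R) :
  'cV[R]_(2 * N) := \col_i f (half_ord i).

Lemma pair_const_fst (R : realType) (N : nat) (f : 'I_N -> R) k :
  pair_const f (pair_fst k) ord0 = f k.
Proof. by rewrite mxE half_pair_fst. Qed.

Lemma pair_const_snd (R : realType) (N : nat) (f : 'I_N -> R) k :
  pair_const f (pair_snd k) ord0 = f k.
Proof. by rewrite mxE half_pair_snd. Qed.

Lemma sum_inv_varphihat2_gt0 (R : realType) (n N : nat)
    (X : 'M[R]_(n, 2 * N)) :
  (0 < N)%N -> fair_design X -> 0 < \sum_(k < N) 1 / varphihat2 X k.
Proof.
case: N X => // N X _ Xf; rewrite big_ord_recl ltr_wpDr //.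
  by apply: sumr_ge0 => k _; rewrite div1r invr_ge0 ltW ?varphihat2_gt0.
by rewrite div1r invr_gt0 varphihat2_gt0.
Qed.

(** * The compatibility constant *)

Lemma compat2_full_pairs (R : realType) (n N : nat) (X : 'M[R]_(n, 2 * N)) :
  (0 < N)%N -> fair_design X -> pairs_orthogonal X ->
  (forall k, 0 < rhohat X k) ->
  compat2_full X = N%:R / \sum_(k < N) 1 / varphihat2 X k.
Proof.
move=> N0 Xf Xo r0; have := sum_inv_varphihat2_gt0 N0 Xf.
set S := \sum_(k < N) _ => S0.
have p0 k : 0 < varphihat2 X k := varphihat2_gt0 k Xf.
have SE c : \sum_(k < N) c / varphihat2 X k = c * S.
  by rewrite mulr_sumr; apply: eq_bigr => k _; rewrite div1r.
(* The factor p is split off: 1 / (2 S) is the minimum of |X b|^2 on the l1 sphere. *)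
have -> : N%:R / S = (2 * N)%:R * (1 / (2 * S)).
  by rewrite natrM; field; rewrite gt_eqF.
apply: set_minE.
  (* Equal entries give equality in [pair_form_ge]; the weights proportional to 1 / varphi_k^2 are
     scaled to l1 norm 1. *)
  exists (pair_const (fun k => 1 / (2 * S) / varphihat2 X k)).
    rewrite /= norm1_pairs.
    under eq_bigr => k _.
      rewrite pair_const_fst pair_const_snd ger0_norm; last first.
        by rewrite !divr_ge0 ?mulr_ge0 ?ltW.
      have -> : 1 / (2 * S) / varphihat2 X k + 1 / (2 * S) / varphihat2 X k
          = S^-1 / varphihat2 X k by field; rewrite !gt_eqF.
      over.
    by rewrite SE mulVf ?gt_eqF.
  congr (_ * _); rewrite norm2_mulmx_pairs //.
  under eq_bigr => k _.
    rewrite pair_const_fst pair_const_snd.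
    have -> : pair_form (rhohat X k) (1 / (2 * S) / varphihat2 X k)
          (1 / (2 * S) / varphihat2 X k)
        = 1 / (2 * S ^+ 2) / varphihat2 X k.
      have := p0 k; rewrite /pair_form /varphihat2 => pk.
      by field; rewrite !gt_eqF.
    over.
  by rewrite SE; field; rewrite gt_eqF.
move=> _ [b /= b1 <-]; apply: ler_wpM2l => //; rewrite norm2_mulmx_pairs //.
set t := fun k => `|b (pair_fst k) ord0| + `|b (pair_snd k) ord0|.
have t1 : \sum_(k < N) t k = 1 by rewrite -norm1_pairs.
(* Tangent lines of [varphi_k^2 t^2 / 2] at the minimizer
   [t = 1 / (varphi_k^2 S)]; they all have slope [1 / S]. *)
have -> : 1 / (2 * S)
    = \sum_(k < N) (t k / S - 1 / (2 * S ^+ 2) / varphihat2 X k).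
  by rewrite sumrB SE -mulr_suml t1; field; rewrite gt_eqF.
apply: ler_sum => k _.
apply: le_trans (pair_form_ge _ _ (ltW (r0 k)) (rhohat_lt1 k Xf)).
rewrite -/(t k) -/(varphihat2 X k) -subr_ge0.
(* The gap between a parabola and its tangent is a square. *)
have -> : varphihat2 X k / 2 * t k ^+ 2 -
      (t k / S - 1 / (2 * S ^+ 2) / varphihat2 X k)
    = (varphihat2 X k * t k - S^-1) ^+ 2 / (2 * varphihat2 X k).
  by field; rewrite !gt_eqF.
by rewrite divr_ge0 ?sqr_ge0 ?mulr_ge0 ?ltW.
Qed.

(** * Identification of the Lasso solution *)

(** Optimality is used against one competitor only, the claimed solution: the objective at any point
    exceeds its value there by at least the form of the deviation. *)
Lemma noiseless_lasso_pairs (R : realType) (n N : nat)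
    (X : 'M[R]_(n, 2 * N)) (lambda : R) (beta0 betas : 'cV[R]_(2 * N)) :
  fair_design X -> pairs_orthogonal X -> (forall k, 0 < rhohat X k) ->
  0 <= lambda ->
  (forall k, lambda / varphihat2 X k <= beta0 (pair_fst k) ord0 /\
             lambda / varphihat2 X k <= beta0 (pair_snd k) ord0) ->
  noiseless_lasso X beta0 lambda betas ->
  betas = beta0 - pair_const (fun k => lambda / varphihat2 X k).
Proof.
move=> Xf Xo r0 l0 ge0; set d := pair_const _ => /(_ (beta0 - d)).
have p0 k : 0 < varphihat2 X k := varphihat2_gt0 k Xf.
rewrite !norm2_mulmx_pairs // !norm1_pairs !mulr_sumr -!big_split /= => opt.
pose q k := pair_form (rhohat X k)
  (betas (pair_fst k) ord0 - (beta0 - d) (pair_fst k) ord0)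
  (betas (pair_snd k) ord0 - (beta0 - d) (pair_snd k) ord0).
have q_ge0 k : 0 <= q k.
  apply: le_trans (pair_form_ge _ _ (ltW (r0 k)) (rhohat_lt1 k Xf)).
  by rewrite mulr_ge0 ?sqr_ge0 // divr_ge0 // ltW ?subr_gt0 ?rhohat_lt1.
have q_le0 : \sum_(k < N) q k <= 0.
  (* The sum added to both sides is the objective at [beta0 - d]. *)
  rewrite -(lerD2l (\sum_(k < N) (pair_form (rhohat X k)
    (lambda / varphihat2 X k) (lambda / varphihat2 X k) +
    2 * lambda * ((beta0 (pair_fst k) ord0 - lambda / varphihat2 X k) +
                  (beta0 (pair_snd k) ord0 - lambda / varphihat2 X k))))).
  rewrite addr0 -big_split /=.
  apply: le_trans (le_trans opt _); apply: ler_sum => k _.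
    rewrite /q !mxE half_pair_fst half_pair_snd.
    apply: pair_objective_ge l0 _.
    by rewrite -/(varphihat2 X k) mulrC divfK ?gt_eqF.
  (* The entries of [beta0 - d] are nonnegative, so its l1 norm is the plain sum of its entries. *)
  have [gef ges] := ge0 k.
  rewrite !mxE half_pair_fst half_pair_snd !ger0_norm ?subr_ge0 //.
  by rewrite /pair_form lerD2r le_eqVlt; apply/orP; left; apply/eqP; ring.
have q0 k : q k = 0.
  apply/eqP; have : \sum_(k < N) q k == 0.
    by rewrite eq_le q_le0 sumr_ge0.
  by rewrite psumr_eq0 // => /allP/(_ k (mem_index_enum k)).
apply: cV_pairs_eq => k.
have [/eqP + /eqP] := pair_form_eq0 (ltW (r0 k)) (rhohat_lt1 k Xf) (q0 k).
by rewrite !subr_eq0 => /eqP -> /eqP ->.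
Qed.

(** * Prediction error and balance with the penalty *)

Theorem lemma7p2 (R : realType) (n N : nat)
    (N_gt0 : (0 < N)%N) (le_2N_n : (2 * N <= n)%N)
    (X : 'M[R]_(n, 2 * N))
    (X_fair : fair_design X)
    (X_orth : pairs_orthogonal X)
    (rho_gt0 : forall k : 'I_N, 0 < rhohat X k)
    (lambda : R) (lambda_gt0 : 0 < lambda)
    (beta0 : 'cV[R]_(2 * N))
    (beta0_ge : forall k : 'I_N,
        beta0 (pair_snd k) ord0 <= beta0 (pair_fst k) ord0 /\
        lambda / varphihat2 X k <= beta0 (pair_snd k) ord0)
    (betas : 'cV[R]_(2 * N))
    (betas_lasso : noiseless_lasso X beta0 lambda betas) :
  [/\ norm2 (X *m (betas - beta0)) ^+ 2
        = lambda ^+ 2 * (2 * N)%:R / compat2_full X,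
      lambda ^+ 2 * (2 * N)%:R / compat2_full X
        = 2 * lambda ^+ 2 * \sum_(k < N) 1 / varphihat2 X k
    & norm2 (X *m (betas - beta0)) ^+ 2 + lambda * norm1 betas
        = lambda * norm1 beta0].
Proof.
have p0 k : 0 < varphihat2 X k := varphihat2_gt0 k X_fair.
have S0 := sum_inv_varphihat2_gt0 N_gt0 X_fair.
have SE c : \sum_(k < N) c / varphihat2 X k
    = c * \sum_(k < N) 1 / varphihat2 X k.
  by rewrite mulr_sumr; apply: eq_bigr => k _; rewrite div1r.
have ge0 k : lambda / varphihat2 X k <= beta0 (pair_fst k) ord0 /\
             lambda / varphihat2 X k <= beta0 (pair_snd k) ord0.
  by have [le_sf ges] := beta0_ge k; split => //; exact: le_trans le_sf.
have eq_betas := noiseless_lasso_pairs X_fair X_orth rho_gt0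
  (ltW lambda_gt0) ge0 betas_lasso.
(* On each pair the error is -d in both entries with d = lambda / varphi_k^2, and the form there is
   2 varphi_k^2 d^2. *)
have predE : norm2 (X *m (betas - beta0)) ^+ 2
    = 2 * lambda ^+ 2 * \sum_(k < N) 1 / varphihat2 X k.
  rewrite -SE norm2_mulmx_pairs // eq_betas; apply: eq_bigr => k _.
  rewrite !mxE half_pair_fst half_pair_snd /pair_form.
  have := p0 k; rewrite /varphihat2 => pk.
  by field; rewrite gt_eqF.
have compatE : lambda ^+ 2 * (2 * N)%:R / compat2_full X
    = 2 * lambda ^+ 2 * \sum_(k < N) 1 / varphihat2 X k.
  rewrite compat2_full_pairs // natrM; field.
  by rewrite pnatr_eq0 -lt0n N_gt0 gt_eqF.
split; [by rewrite predE compatE|by []|].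
(* On each pair the l1 norm drops by 2 lambda / varphi_k^2; times lambda, this is exactly the
   prediction error of the pair. *)
rewrite predE eq_betas -SE !norm1_pairs !mulr_sumr -big_split /=.
apply: eq_bigr => k _; have [gef ges] := ge0 k.
have d0 : 0 <= lambda / varphihat2 X k by rewrite divr_ge0 ?ltW.
rewrite !mxE half_pair_fst half_pair_snd !ger0_norm ?subr_ge0 //.
- by field; rewrite gt_eqF.
- exact: le_trans ges.
- exact: le_trans gef.
Qed.
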